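(* Let $X$ be a real Banach space and let $f:X\times X^*\to\overline{\mathbb{R}}$ be a proper convex lower semicontinuous function. Then, for any $(x^{**},x^* )\in X^{**}\times X^*$ there exists a bounded net $\{(z_i,z_i^* )\}_{i\in I}$ in $X\times X^*$ which converges to $(x^{**},x^* )$ in the $\sigma(X^{**},X^* )\times$strong topology of $X^{**}\times X^*$ and $$f^{**}(x^{**},x^* )=\lim_{i\in I}f(z_i,z_i^* ).$$
   Context: $X$ is a real Banach space with dual $X^*$ and bidual $X^{**}$; $X$ is identified with its canonical image in $X^{**}$ (and $X^*$ with its image in $X^{***}$). $\overline{\mathbb{R}}=[-\infty,\infty]$. $\langle x,x^*\rangle=x^*(x)$ and $\langle x^*,x^{**}\rangle=x^{**}(x^* )$ denote the duality products. A function $f$ is proper if $f>-\infty$ everywhere and $f$ is not identically $\infty$. Lower semicontinuity of $f$ is with respect to the strong (norm) topology of $X\times X^*$. Conjugates: $(X\times X^* )^*=X^*\times X^{**}$, and $f^*(x^*,x^{**})=\sup_{(y,y^* )\in X\times X^*}\langle y,x^*\rangle+\langle y^*,x^{**}\rangle-f(y,y^* )$ on $X^*\times X^{**}$. The biconjugate $f^{**}=(f^* )^*$ is considered at points of $X^{**}\times X^*\subset X^{**}\times X^{***}$: $f^{**}(x^{**},x^* )=\sup_{(y^*,y^{**})\in X^*\times X^{**}}\langle y^*,x^{**}\rangle+\langle x^*,y^{**}\rangle-f^*(y^*,y^{**})$. The $\sigma(X^{**},X^* )\times$strong topology is the product of the weak-* topology of $X^{**}$ and the norm topology of $X^*$.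 The limit of $f(z_i,z_i^* )$ is taken in $\overline{\mathbb{R}}$ (it may be $\infty$). *)

(* Defs.v *)
From HB Require Import structures.
From mathcomp Require Import all_boot all_order all_algebra.
From mathcomp Require Import all_classical all_reals all_analysis.

Set Implicit Arguments.
Unset Strict Implicit.
Unset Printing Implicit Defensive.

Import Order.TTheory GRing.Theory Num.Theory.
Import numFieldNormedType.Exports.

Local Open Scope classical_set_scope.
Local Open Scope ring_scope.

Section Dual.
Context {R : realType} {V : normedModType R}.

Definition continuous_linear : {pred V -> R^o} :=
  mem [set f : V -> R^o | linear f /\ continuous f].

Lemma continuous_linear_submod_closed : submod_closed continuous_linear.
Proof.
split=> [|a f g].
  rewrite inE; split; last exact: cst_continuous.
  by move=> a x y; rewrite scaler0 addr0.
rewrite !inE => -[lf cf] [lg cg]; split.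
  move=> b x y.
  rewrite !fctE /= lf lg !scalerDr !scalerA (mulrC b a) !addrA.
  by congr (_ + _); rewrite -!addrA; congr (_ + _); rewrite addrC.
by move=> x; apply: cvgD; [apply: cvgZl_tmp; exact: cf | exact: cg].
Qed.

HB.instance Definition _ := GRing.isSubmodClosed.Build _ _ continuous_linear
  continuous_linear_submod_closed.

End Dual.

Record dual (R : realType) (V : normedModType R) := Dual {
  dual_fun :> V -> R^o ;
  dual_funP : dual_fun \in continuous_linear
}.

Section DualTheory.
Context {R : realType} {V : normedModType R}.

HB.instance Definition _ := [isSub for @dual_fun R V].
HB.instance Definition _ := [Choice of dual V by <:].
HB.instance Definition _ := [SubChoice_isSubLmodule of dual V by <:].

Implicit Types f g : dual V.

Lemma dual_linear f : linear (f : V -> R^o).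
Proof. by have := dual_funP f; rewrite inE => -[]. Qed.

HB.instance Definition _ f :=
  GRing.isLinear.Build R V R^o *:%R (dual_fun f) (@dual_linear f).

Lemma dual_continuous f : continuous (f : V -> R^o).
Proof. by have := dual_funP f; rewrite inE => -[]. Qed.

Lemma dualP f g : (forall x, f x = g x) -> f = g.
Proof. by move=> fg; apply/val_inj/funext. Qed.

Definition opnorm f : R := sup [set `|f x| | x in [set x : V | `|x| <= 1]].

Lemma opnorm_has_sup f : has_sup [set `|f x| | x in [set x : V | `|x| <= 1]].
Proof.
split; first by exists `|f 0|, 0 => //=; rewrite normr0.
have /linear_boundedP/pinfty_ex_gt0[M M0 fM] :=
  continuous_linear_bounded (0 : V) (@dual_continuous f 0).
exists M => _ [x x1 <-]; apply: le_trans (fM x) _.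
by rewrite ler_piMr// ltW.
Qed.

Lemma opnorm_ub f x : `|x| <= 1 -> `|f x| <= opnorm f.
Proof.
by move=> x1; apply: ub_le_sup; [case: (opnorm_has_sup f)|exists x].
Qed.

Lemma opnorm_le f M : (forall x, `|x| <= 1 -> `|f x| <= M) -> opnorm f <= M.
Proof.
move=> fM; apply: ge_sup; first by case: (opnorm_has_sup f).
by move=> _ [x x1 <-]; exact: fM.
Qed.

Lemma opnormD f g : opnorm (f + g) <= opnorm f + opnorm g.
Proof.
apply: opnorm_le => x x1; apply: (le_trans (ler_normD _ _)).
by apply: lerD; exact: opnorm_ub.
Qed.

Lemma opnorm_ge0 f : 0 <= opnorm f.
Proof. by apply: le_trans (opnorm_ub f (_ : `|0| <= 1)); rewrite ?normr0. Qed.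

Lemma opnormZ (a : R) f : opnorm (a *: f) = `|a| * opnorm f.
Proof.
have ub b h : opnorm (b *: h) <= `|b| * opnorm h.
  apply: opnorm_le => x x1.
  have -> : (b *: h) x = b *: h x by [].
  by rewrite normrZ ler_wpM2l// opnorm_ub.
apply/eqP; rewrite eq_le ub /=.
have [->|a0] := eqVneq a 0; first by rewrite normr0 mul0r opnorm_ge0.
rewrite -ler_pdivlMl ?normr_gt0// -normfV.
by apply: le_trans (ub _ _); rewrite scalerA mulVf// scale1r.
Qed.

Lemma opnorm_eq0 f : opnorm f = 0 -> f = 0.
Proof.
move=> f0; apply: dualP => x; apply/eqP; rewrite -normr_le0.
have [->|x0] := eqVneq x 0; first by rewrite linear0 normr0.
have := @opnorm_ub f (`|x|^-1 *: x).
rewrite f0 linearZ !normrZ normfV normr_id mulVf ?normr_eq0// => /(_ (lexx _)).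
by rewrite pmulr_rle0// invr_gt0 normr_gt0.
Qed.

HB.instance Definition _ :=
  @Lmodule_isNormed.Build R (dual V) opnorm opnormD opnormZ opnorm_eq0.

Lemma dual_normE f : `|f| = opnorm f. Proof. by []. Qed.

Lemma dual_norm_le f x : `|f x| <= `|f| * `|x|.
Proof.
have [->|x0] := eqVneq x 0; first by rewrite linear0 !normr0 mulr0.
rewrite -ler_pdivrMr ?normr_gt0// mulrC.
have := @opnorm_ub f (`|x|^-1 *: x).
by rewrite linearZ !normrZ normfV normr_id mulVf ?normr_eq0//; apply.
Qed.

End DualTheory.

Section Bidual.
Context {R : realType} {V : normedModType R}.

Lemma eval_continuous_linear (x : V) :
  (fun f : dual V => f x : R^o) \in continuous_linear.
Proof.
have lin : linear (fun f : dual V => f x : R^o) by [].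
rewrite inE; split=> //.
pose L := GRing.isLinear.Build R (dual V) R^o *:%R _ lin.
pose e : {linear dual V -> R^o} := HB.pack (fun f : dual V => f x : R^o) L.
apply: (@bounded_linear_continuous _ _ _ e).
apply/linear_boundedP; near=> r => f /=.
rewrite (le_trans (dual_norm_le f x))// mulrC ler_wpM2r//.
Unshelve. all: by end_near. Qed.

(* the canonical embedding V -> V^** *)
Definition bidual_emb (x : V) : dual (dual V) :=
  Dual (eval_continuous_linear x).

End Bidual.

(* [dual V] with the weak-* topology sigma(dual V, V) instead of the norm
   topology *)
Definition weak_star (R : realType) (V : normedModType R) : Type :=
  initial_topology (fun f : dual V => (f : V -> R) : {ptws V -> R}).

HB.instance Definition _ (R : realType) (V : normedModType R) :=
  Uniform.on (weak_star V).

Lemma weak_star_cvgP (R : realType) (V : normedModType R)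
    (F : set_system (dual V)) (f : dual V) :
  Filter F ->
  F --> (f : weak_star V) <-> forall x : V, (g x : R) @[g --> F] --> (f x : R).
Proof.
move=> FF; pose i (g : dual V) : {ptws V -> R} := (g : V -> R).
split=> [cvF x|cvF].
  have : i @ F --> i f.
    apply: cvg_trans (@initial_continuous _ _ i f).
    exact: cvg_app cvF.
  by move=> /pointwise_cvgP/(_ x).
have iF : i @ F --> i f by apply/pointwise_cvgP.
move=> A [_ [[B Bop <-] Bf sBA]].
apply: filterS sBA _.
by apply: iF; exact: open_nbhs_nbhs.
Qed.

Section Convex_analysis.
Context {R : realType}.
Local Open Scope ereal_scope.

Definition proper_efun {T : Type} (f : T -> \bar R) :=
  (forall x, -oo < f x) /\ (exists x, f x != +oo).

(* [-oo + +oo] is [-oo] in [\bar R], so that this inequality is meant only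
   for functions that avoid [-oo] *)
Definition convex_efun {V : lmodType R} (f : V -> \bar R) :=
  forall (t : R) (x y : V), (0 < t < 1)%R ->
    f (t *: x + (1 - t) *: y)%R <= t%:E * f x + (1 - t)%:E * f y.

(* Fenchel conjugate of a function on [V * W], with [dual (V * W)] identified
   with [dual V * dual W]. *)
Definition fenchel_conj {V W : normedModType R} (f : V * W -> \bar R)
    (p : dual V * dual W) : \bar R :=
  ereal_sup [set (p.1 y.1 + p.2 y.2)%:E - f y | y in [set: V * W]].

End Convex_analysis.

Section Nets.
Context {I : Type}.

Definition directed_preorder (le : I -> I -> Prop) :=
  [/\ (exists i : I, True), (forall i, le i i),
      (forall i j k, le i j -> le j k -> le i k) &
      (forall i j, exists2 k, le i k & le j k)].

(* A net [z : I -> T] converges to [l] when [z i @[i --> net_filter le] --> l]. *)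
Definition net_filter (le : I -> I -> Prop) : set_system I :=
  filter_from [set: I] (fun i => [set j | le i j]).

Lemma net_filter_proper (le : I -> I -> Prop) :
  directed_preorder le -> ProperFilter (net_filter le).
Proof.
move=> [[i0 _] lexx letr dir]; apply: filter_from_proper.
  apply: filter_from_filter; first by exists i0.
  move=> i j _ _; have [k ik jk] := dir i j; exists k => // l /= kl.
  by split; [exact: letr ik kl | exact: letr jk kl].
by move=> i _; exists i; exact: lexx.
Qed.

End Nets.

(* Main.v *)
Require Import Defs.
From HB Require Import structures.
From mathcomp Require Import all_boot all_order all_algebra.
From mathcomp Require Import all_classical all_reals all_analysis.
From mathcomp Require Import ring lra.

(* Let y_1, ..., y_n be finitely many elements of the dual of X. For small
   d > 0 and large N, the infimum over z in X x X^* of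
     f z + d |z.1| + N sum_i |y_i z.1 - xss y_i| + N |z.2 - xs|
   is at most f^** (xss, xs) + d |xss|: by the Hahn-Banach theorem, applied to f
   and the sublinear penalty, a larger infimum would produce an affine minorant
   of f that contradicts the definition of f^**. If one of the y_i comes from an
   affine minorant of f that almost attains f^** (xss, xs), then N can be chosen
   so that near-minimizers z satisfy |z.1| <= |xss| + 2 however small d is.
   This gives the bounded net and the upper bound on the limit of f; the lower
   bound holds along every net converging in this topology, because f dominates
   its affine minorants. When f^** (xss, xs) is infinite only that lower bound
   matters, and the net is obtained from the function 0 in place of f. *)

Set Implicit Arguments.
Unset Strict Implicit.
Unset Printing Implicit Defensive.

Import Order.TTheory GRing.Theory Num.Theory.
Import numFieldNormedType.Exports.

Local Open Scope classical_set_scope.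
Local Open Scope ring_scope.

(** * Sublinear functionals and the Hahn-Banach-Lagrange theorem *)

Section Hahn_Banach.
Context {R : realType} {E : lmodType R}.
Implicit Types (p q : E -> R) (S : set (E * R)).

Definition sublinear p :=
  (forall x y, p (x + y) <= p x + p y) /\
  (forall (t : R) x, 0 <= t -> p (t *: x) = t * p x).

Definition convex_cone S :=
  [/\ S (0, 0), (forall c d, S c -> S d -> S (c.1 + d.1, c.2 + d.2)) &
      (forall (t : R) c, 0 < t -> S c -> S (t *: c.1, t * c.2))].

Lemma sublinear0 p : sublinear p -> p 0 = 0.
Proof. by move=> [_ pZ]; rewrite -(scale0r 0) pZ// mul0r. Qed.

Lemma sublinear_ge_opp p x : sublinear p -> - p (- x) <= p x.
Proof.
move=> sp; rewrite -subr_ge0 opprK -(sublinear0 sp) -(addrN x).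
by case: sp => pD _; exact: pD.
Qed.

(** The infimum of [p (x + c.1) - c.2] over [c] in [S] works: subadditivity and [c.2 <= p c.1] keep
    it above [- p (- x)], so it is finite, and the cone structure of [S] makes it sublinear. *)
Lemma sublinear_tilt p S : sublinear p -> convex_cone S ->
  (forall c, S c -> c.2 <= p c.1) ->
  exists q, [/\ sublinear q, (forall x, q x <= p x) &
    forall c, S c -> q (- c.1) <= - c.2].
Proof.
move=> sp [S0 SD SZ] Sp.
pose A x := [set p (x + c.1) - c.2 | c in S].
pose q x := inf (A x).
have A0 x : A x !=set0 by exists (p (x + 0) - 0), (0, 0).
have lbA x : lbound (A x) (- p (- x)).
  move=> _ [c Sc <-]; have := sp.1 (x + c.1) (- x).
  by rewrite addrAC subrr add0r; have := Sp c Sc; lra.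
have qA x c : S c -> q x <= p (x + c.1) - c.2.
  by move=> Sc; apply: ge_inf; [exists (- p (- x)); exact: lbA|exists c].
have qle x m : (forall c, S c -> m <= p (x + c.1) - c.2) -> m <= q x.
  by move=> h; apply: lb_le_inf => // _ [c Sc <-]; exact: h.
have qp x : q x <= p x by have := qA x _ S0; rewrite /= addr0 subr0.
have qZ (t : R) x : 0 < t -> q (t *: x) <= t * q x.
  move=> t0; rewrite mulrC -ler_pdivrMr//; apply: (qle) => c Sc.
  rewrite ler_pdivrMr// [leRHS]mulrC; apply: le_trans (qA _ _ (SZ t c t0 Sc)) _.
  by rewrite /= -scalerDr (sp.2 _ _ (ltW t0)) mulrBr.
have q0 : q 0 = 0.
  apply/eqP; rewrite eq_le; apply/andP; split.
    by have := qp 0; rewrite (sublinear0 sp).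
  by apply: (qle) => c Sc; rewrite add0r subr_ge0 Sp.
exists q; split=> //; last first.
  by move=> c Sc; have := qA (- c.1) c Sc; rewrite addNr (sublinear0 sp) sub0r.
split=> [x y|t x].
  rewrite -lerBlDr; apply: (qle) => c Sc; rewrite lerBlDl -lerBlDr.
  apply: (qle) => d Sd; have := qA (x + y) _ (SD _ _ Sc Sd).
  have /= := sp.1 (x + c.1) (y + d.1); rewrite addrACA; lra.
rewrite le_eqVlt => /predU1P[<-|t0]; first by rewrite scale0r mul0r.
apply/eqP; rewrite eq_le qZ//=.
have := qZ t^-1 (t *: x); rewrite invr_gt0 => /(_ t0).
by rewrite scalerA mulVf ?gt_eqF// scale1r ler_pdivlMl.
Qed.

(** Zorn's lemma on the sublinear functionals below [p]: the pointwise infimum of a nonempty chain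
    is again sublinear, and it is finite because every member dominates [- p (- x)]. *)
Lemma sublinear_minimal p : sublinear p ->
  exists q, [/\ sublinear q, (forall x, q x <= p x) &
    forall q', sublinear q' -> (forall x, q' x <= q x) -> q' = q].
Proof.
move=> sp.
pose T := {q | sublinear q /\ forall x, q x <= p x}.
have Tge (r : T) x : - p (- x) <= sval r x.
  case: r => r [sr rp] /=.
  by apply: le_trans (sublinear_ge_opp x sr); rewrite lerN2.
pose r0 : T := exist _ p (conj sp (fun x => lexx (p x))).
(* Zorn's lemma yields maximal elements, so the pointwise order is reversed. *)
pose le (q r : T) : bool := `[< forall x, sval r x <= sval q x >].
have [] := @ZL_preorder T r0 le.
- by move=> r; apply/asboolP.
- move=> s r t /asboolP h /asboolP h'; apply/asboolP => x.
  exact: le_trans (h' x) (h x).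
- move=> A totA.
  have [->|/set0P[a Aa]] := eqVneq A set0; first by exists r0.
  pose B x := [set sval r x | r in A].
  pose b x := inf (B x).
  have B0 x : B x !=set0 by exists (sval a x), a.
  have bA x r : A r -> b x <= sval r x.
    move=> Ar; apply: ge_inf; last by exists r.
    by exists (- p (- x)) => _ [r' _ <-]; exact: Tge.
  have ble x m : (forall r, A r -> m <= sval r x) -> m <= b x.
    by move=> h; apply: lb_le_inf => // _ [r Ar <-]; exact: h.
  have sb : sublinear b.
    split=> [x y|t x].
      rewrite -lerBlDr; apply: (ble) => r Ar; rewrite lerBlDl -lerBlDr.
      apply: (ble) => s As.
      (* Of two members of a chain, the smaller one serves for both [x] and [y]. *)
      wlog: x y r s Ar As / le r s.
        move=> wlog; have [rs|sr] := totA r s Ar As; first exact: wlog.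
        by have := wlog y x s r As Ar sr; rewrite (addrC y); lra.
      move=> /asboolP/(_ x) rs; have := bA (x + y) _ As.
      by have := (svalP s).1.1 x y; lra.
    rewrite le_eqVlt => /predU1P[<-|t0].
      rewrite scale0r mul0r; apply/eqP; rewrite eq_le; apply/andP; split.
        by have := bA 0 _ Aa; rewrite (sublinear0 (svalP a).1).
      by apply: (ble) => r _; rewrite (sublinear0 (svalP r).1).
    apply/eqP; rewrite eq_le -ler_pdivrMl//; apply/andP; split.
      apply: (ble) => r Ar; rewrite ler_pdivrMl// -((svalP r).1.2 _ _ (ltW t0)).
      exact: bA.
    by apply: (ble) => r Ar; rewrite ((svalP r).1.2 _ _ (ltW t0)) (ler_pM2l t0)
      bA.
  have bp x : b x <= p x by apply: le_trans (bA x a Aa) ((svalP a).2 x).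
  exists (exist _ b (conj sb bp)) => s As; apply/asboolP => x /=.
  exact: bA.
move=> [q [sq qp]] qmax; exists q; split=> // q' sq' q'q.
have q'p x : q' x <= p x by apply: le_trans (q'q x) (qp x).
have := qmax (exist _ q' (conj sq' q'p)); move=> /(_ _)/asboolP/=.
move=> h; apply/funext => x; apply/eqP; rewrite eq_le q'q/=.
by apply: h; apply/asboolP.
Qed.

(* A minimal sublinear functional is linear: tilting it along the ray spanned
   by (y, q y) must leave it unchanged, hence q (- y) <= - q y. *)
Lemma sublinear_linear p : sublinear p ->
  exists L : {linear E -> R^o}, forall x, L x <= p x.
Proof.
move=> /sublinear_minimal[q [sq qp qmin]].
have qN y : q (- y) = - q y.
  apply/eqP; rewrite eq_le; apply/andP; split; last first.
    by have := sublinear_ge_opp (- y) sq; rewrite opprK.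
  pose S : set (E * R) := [set c | exists2 t, 0 <= t & c = (t *: y, t * q y)].
  have [|c [t t0 ->]|r [sr rq rS]] := @sublinear_tilt q S sq.
  - split.
    + by exists 0 => //; rewrite scale0r mul0r.
    + move=> _ _ [s s0 ->] [t t0 ->]; exists (s + t); first exact: addr_ge0.
      by rewrite /= scalerDl mulrDl.
    + move=> s _ s0 [t t0 ->]; exists (s * t).
        by rewrite mulr_ge0 // ltW.
      by rewrite /= scalerA mulrA.
  - by rewrite /= sq.2.
  rewrite -(qmin r sr rq); apply: (rS (y, r y)).
  by exists 1 => //; rewrite scale1r mul1r (qmin r sr rq).
have qD x y : q (x + y) = q x + q y.
  apply/eqP; rewrite eq_le sq.1/=.
  by have := sq.1 (x + y) (- y); rewrite addrK qN; lra.
have lq : linear (q : E -> R^o).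
  move=> t x y; rewrite qD; congr (_ + _).
  have [t0|t0] := leP 0 t; first by rewrite sq.2.
  by rewrite -[t in LHS]opprK scaleNr qN sq.2 ?oppr_ge0 ?ltW// mulNr opprK.
pose L : {linear E -> R^o} :=
  HB.pack (q : E -> R^o) (GRing.isLinear.Build R E R^o *:%R _ lq).
by exists L.
Qed.

(* Hahn-Banach-Lagrange theorem *)
Lemma convex_sublinear_linear (V : lmodType R) (f : V -> \bar R) (j : V -> E)
    p (m : R) :
  sublinear p -> (forall v, (-oo < f v)%E) -> convex_efun f ->
  (forall t x y, j (t *: x + (1 - t) *: y) = t *: j x + (1 - t) *: j y) ->
  (forall v, (m%:E <= f v + (p (j v))%:E)%E) ->
  exists2 L : {linear E -> R^o}, (forall x, L x <= p x) &
    forall v, (m%:E <= f v + (L (j v))%:E)%E.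
Proof.
move=> sp fNy fcvx jaff mf.
(* The cone spanned by the points [(j v, m - r)] with [r >= f v]. The hypothesis puts it below [p],
   and convexity of [f] makes it convex. Tilting [p] along it gives [q (- j v) <= r - m], hence
   [L (j v) >= m - r] for every linear [L] below [q]. *)
pose S : set (E * R) := [set c | c = (0, 0) \/ exists t v r,
  [/\ 0 < t, (f v <= r%:E)%E & c = (t *: j v, t * (m - r))]].
have [| |q [sq qp qS]] := @sublinear_tilt p S sp.
- split; first by left.
  + move=> c d [->/=|[s [v [r [s0 vr ->/=]]]]].
      by rewrite !add0r -surjective_pairing.
    move=> [->/=|[s' [v' [r' [s'0 vr' ->/=]]]]].
      by rewrite !addr0; right; exists s, v, r.
    have ss0 : s + s' != 0 by rewrite gt_eqF// addr_gt0.
    (* With this weight, [s *: j v + s' *: j v'] is [s + s'] times a convex combination. *)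
    pose t := s / (s + s').
    have t1 : 1 - t = s' / (s + s') by rewrite /t; field.
    have t01 : 0 < t < 1.
      by rewrite -[t < 1]subr_gt0 t1 !divr_gt0// addr_gt0.
    right; exists (s + s'), (t *: v + (1 - t) *: v'), (t * r + (1 - t) * r').
    split; first exact: addr_gt0.
      apply: le_trans (fcvx _ _ _ t01) _.
      have /andP[t0 t2] := t01.
      rewrite [leRHS]EFinD !EFinM; apply: leeD; apply: lee_wpmul2l => //.
        by rewrite lee_fin ltW.
      by rewrite lee_fin subr_ge0 ltW.
    rewrite jaff scalerDr !scalerA t1; congr (_ *: _ + _ *: _, _);
      by rewrite /t; field.
  + move=> t c t0 [->/=|[s [v [r [s0 vr ->/=]]]]].
      by left; rewrite scaler0 mulr0.
    by right; exists (t * s), v, r; rewrite scalerA mulrA mulr_gt0.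
- move=> c [->/=|[s [v [r [s0 vr ->/=]]]]]; first by rewrite (sublinear0 sp).
  rewrite (sp.2 _ _ (ltW s0)) ler_pM2l// lerBlDl -lee_fin EFinD.
  by apply: le_trans (mf v) _; apply: leeD.
have [L Lq] := sublinear_linear sq.
exists L => [x|v]; first exact: le_trans (Lq x) (qp x).
have := mf v; case fv: (f v) (fNy v) => [r||] // _ _.
rewrite -EFinD lee_fin.
have /qS/= : S (1 *: j v, 1 * (m - r)).
  by right; exists 1, v, r; rewrite fv.
rewrite scale1r mul1r; have := Lq (- j v); rewrite linearN; lra.
Qed.

End Hahn_Banach.

(** * Affine minorants and the Fenchel conjugate *)

Section Fenchel.
Context {R : realType}.

(** The one-sided bound, used at [x] and at [- x], bounds the absolute value. *)
Lemma linear_bounded_dual (V : normedModType R) (g : V -> R^o) (K : R) :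
  linear g -> (forall x, g x <= K * `|x|) ->
  exists y : dual V, forall x, y x = g x.
Proof.
move=> lg gK.
pose L : {linear V -> R^o} :=
  HB.pack g (GRing.isLinear.Build R V R^o *:%R _ lg).
have cL : continuous L.
  apply: bounded_linear_continuous; apply/linear_boundedP.
  exists K; split; first exact: num_real.
  move=> r Kr x; rewrite ler_norml lerNl -linearN /=.
  have le y : g y <= r * `|y|.
    by apply: le_trans (gK y) _; rewrite ler_wpM2r// ltW.
  by rewrite -[X in _ * X]normrN le normrN le.
have P : (g : V -> R^o) \in continuous_linear by rewrite inE; split.
by exists (Dual P).
Qed.

Lemma dual_norm_le_bound (V : normedModType R) (y : dual V) (K : R) :
  0 <= K -> (forall x, y x <= K * `|x|) -> `|y| <= K.
Proof.
move=> K0 yK; apply: opnorm_le => x x1.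
have le v : `|v| <= 1 -> y v <= K.
  by move=> v1; apply: le_trans (yK v) _; rewrite ler_piMr.
by rewrite ler_norml lerNl -linearN !le ?normrN.
Qed.

(** Turns real upper bounds on the conjugate into affine minorants of [f], the form in which
    conjugates enter the later arguments. Both sides fail if [f] takes the value [-oo]. *)
Lemma fenchel_conj_le (V W : normedModType R) (f : V * W -> \bar R)
    (y : dual V * dual W) (b : R) :
  (fenchel_conj f y <= b%:E)%E <->
  forall z, ((y.1 z.1 + y.2 z.2 - b)%:E <= f z)%E.
Proof.
split=> [h z|h].
  have : ((y.1 z.1 + y.2 z.2)%:E - f z <= b%:E)%E.
    by apply: le_trans h; apply: ereal_sup_ubound; exists z.
  by case: (f z) => [r| |]//; rewrite ?leey// -EFinB !lee_fin; lra.
apply: ge_ereal_sup => _ [z _ <-].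
have := h z; case: (f z) => [r| |]//; last by rewrite leNye.
by rewrite -EFinB !lee_fin; lra.
Qed.

Lemma fenchel_conj_gtNy (V W : normedModType R) (f : V * W -> \bar R)
    (y : dual V * dual W) :
  (exists z, f z != +oo%E) -> (-oo < fenchel_conj f y)%E.
Proof.
move=> [z fz]; apply: (@lt_le_trans _ _ ((y.1 z.1 + y.2 z.2)%:E - f z)%E).
  by case: (f z) fz => [a| |]; rewrite ?eqxx// -?EFinB ?ltNyr ?ltNye.
by apply: ereal_sup_ubound; exists z.
Qed.

(** Lower semicontinuity gives [f > f z0 - 1] on a ball of radius [r] around [z0]. By convexity,
    [f z + (2 / r) * |z - z0|] is at least [f z0 - 1] everywhere, and the Hahn-Banach-Lagrange
    theorem replaces the norm term by a continuous linear one. *)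
Lemma lsc_convex_minorant (V W : normedModType R) (f : V * W -> \bar R) :
  proper_efun f -> convex_efun f -> lower_semicontinuous f ->
  exists y, fenchel_conj f y != +oo%E.
Proof.
move=> [fNy [z0 fz0]] fcvx flsc.
case fz0E : (f z0) fz0 (fNy z0) => [r0| |]// _ _.
have [A /nbhs_ballP[r /= r_gt0 rA] Af] : exists2 A, nbhs z0 A &
    forall z, A z -> ((r0 - 1)%:E < f z)%E.
  by apply: flsc; rewrite fz0E lte_fin; lra.
have fr z : `|z - z0| < r -> ((r0 - 1)%:E < f z)%E.
  by move=> zr; apply/Af/rA; rewrite -ball_normE /ball_/= distrC.
pose N := 2 / r.
have N0 : 0 < N by rewrite divr_gt0.
pose p (z : V * W) : R := N * `|z|.
have sp : sublinear p.
  split=> [x y|t x t0]; rewrite /p -?mulrDr.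
    by rewrite ler_wpM2l ?ler_normD// ltW.
  by rewrite normrZ ger0_norm//; ring.
have [||L Lp Lf] := @convex_sublinear_linear _ _ _ f
  (fun z => z - z0) p (r0 - 1) sp fNy fcvx.
- by move=> t x y; rewrite !scalerBr addrACA -opprD -scalerDl subrKC scale1r.
- move=> z; have [/fr zr|rz] := ltP `|z - z0| r.
    apply: le_trans (ltW zr) _; rewrite leeDl// lee_fin /p.
    by rewrite mulr_ge0 ?normr_ge0 ?(ltW N0).
  have nz : 0 < `|z - z0| by exact: lt_le_trans rz.
  (* This [t] moves [z] to distance [r / 2] from [z0], inside the ball, and satisfies
     [t^-1 = N * |z - z0|]. Dividing the convexity inequality by [t] gives [f z + t^-1 > r0]. *)
  pose t := r / (2 * `|z - z0|).
  have t01 : 0 < t < 1.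
    rewrite divr_gt0 ?mulr_gt0//= ltr_pdivrMr ?mulr_gt0// mul1r; lra.
  have tz : `|t *: z + (1 - t) *: z0 - z0| < r.
    have -> : t *: z + (1 - t) *: z0 - z0 = t *: (z - z0).
      by rewrite scalerBl scale1r scalerBr [z0 - _]addrC addrA addrK.
    rewrite normrZ.
    rewrite gtr0_norm; last by case/andP: t01.
    have -> : t * `|z - z0| = r / 2 by rewrite /t; field; rewrite gt_eqF.
    lra.
  have := lt_le_trans (fr _ tz) (fcvx t z z0 t01).
  rewrite fz0E; case: (f z) (fNy z) => [a| |]//= _; last first.
    by rewrite leey.
  rewrite -!EFinM -!EFinD lte_fin lee_fin => h.
  have /andP[t0 t1] := t01.
  rewrite /p; have -> : N * `|z - z0| = t^-1.
    by rewrite /N /t; field; rewrite !gt_eqF.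
  have tt : t * t^-1 = 1 by rewrite mulfV// gt_eqF.
  by rewrite -(ler_pM2l t0) !mulrDr tt; nra.
have [||y1 y1E] := @linear_bounded_dual V (fun x => L (x, 0)) N.
- move=> t x y /=; rewrite -linearP; congr (L (_, _)).
  by rewrite /= scaler0 addr0.
- move=> x; apply: le_trans (Lp _) _; rewrite /p prod_normE/= normr0.
  by rewrite max_l.
have [||y2 y2E] := @linear_bounded_dual W (fun x => L (0, x)) N.
- move=> t x y /=; rewrite -linearP; congr (L (_, _)).
  by rewrite /= scaler0 addr0.
- move=> x; apply: le_trans (Lp _) _; rewrite /p prod_normE/= normr0.
  by rewrite max_r.
have yL z : y1 z.1 + y2 z.2 = L z.
  rewrite y1E y2E -linearD; congr (L _).
  by case: z => a b; congr (_, _); rewrite /= ?addr0 ?add0r.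
(* The minorant is [r0 - 1 - L (z - z0)], whence the signs. *)
pose y : dual V * dual W := (- y1, - y2); exists y.
suff : (fenchel_conj f y <= (- (r0 - 1 + L z0))%:E)%E by case: fenchel_conj.
apply/fenchel_conj_le => z; have := Lf z.
have -> : L (z - z0) = (y1 z.1 + y2 z.2) - L z0 :> R by rewrite yL linearB.
have -> : y.1 z.1 = - (y1 z.1 : R) :> R by [].
have -> : y.2 z.2 = - (y2 z.2 : R) :> R by [].
case: (f z) => [a| |]; rewrite ?leey// -EFinD !lee_fin; lra.
Qed.

End Fenchel.

(** * Penalized minimization and approximation of the biconjugate *)

Section Biconjugate.
Context {R : realType} {V W : normedModType R}.
Implicit Types (f : V * W -> \bar R) (xss : dual (dual V)) (w : W).

(** Otherwise a linear [L] below the penalty gives an affine minorant of [f] with slope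
    [(- y1, - y2)], where [y1] is some [y0] with [|y0| <= d] plus a combination of the [xi i]. The
    [xi] part of the minorant is centred at [xss] and contributes nothing to its value there, so
    only [y0] costs anything, at most [d * |xss|]. *)
Lemma penalized_inf_lt f xss w (c d N e : R) n (xi : 'I_n -> dual V) :
  (forall z, (-oo < f z)%E) -> convex_efun f ->
  (fenchel_conj (fenchel_conj f) (xss, bidual_emb w) <= c%:E)%E ->
  0 <= d -> 0 <= N -> 0 < e ->
  exists z, (f z + (d * `|z.1| + N * (\sum_i `|xi i z.1 - xss (xi i)|) +
    N * `|z.2 - w|)%:E < (c + d * `|xss| + e)%:E)%E.
Proof.
move=> fNy fcvx fc d0 N0 e0; apply: contrapT => /forallNP hN.
pose m := c + d * `|xss| + e.
pose p (u : V * 'rV[R]_n * W) : R :=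
  d * `|u.1.1| + N * (\sum_i `|u.1.2 0 i|) + N * `|u.2|.
(* The offsets make [j] affine rather than linear, so the penalty is [p (j z)] with [p]
   sublinear. *)
pose j (z : V * W) : V * 'rV[R]_n * W :=
  (z.1, \row_i (xi i z.1 - xss (xi i)), z.2 - w).
have sp : sublinear p.
  split=> [x y|t x t0].
    have s : \sum_i `|x.1.2 0 i + y.1.2 0 i| <=
        \sum_i `|x.1.2 0 i| + \sum_i `|y.1.2 0 i|.
      by rewrite -big_split; apply: ler_sum => i _; exact: ler_normD.
    have -> : p (x + y) = d * `|x.1.1 + y.1.1| +
        N * (\sum_i `|x.1.2 0 i + y.1.2 0 i|) + N * `|x.2 + y.2|.
      by rewrite /p; congr (_ + N * _ + _); apply: eq_bigr => i _; rewrite mxE.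
    have := ler_wpM2l d0 (ler_normD x.1.1 y.1.1).
    have := ler_wpM2l N0 (ler_normD x.2 y.2).
    have := ler_wpM2l N0 s; rewrite /p; lra.
  rewrite /p /= !normrZ ger0_norm// !mulrDr; congr (_ + _ + _).
  - by rewrite mulrCA.
  - rewrite mulrCA; congr (_ * _); rewrite mulr_sumr.
    by apply: eq_bigr => i _; rewrite mxE normrM ger0_norm.
  - by rewrite mulrCA.
have jaff (t : R) x y : j (t *: x + (1 - t) *: y) = t *: j x + (1 - t) *: j y.
  congr (_, _, _) => /=.
    apply/rowP => i; rewrite !mxE linearD !linearZ /=.
    by rewrite /GRing.scale/=; ring.
  by rewrite !scalerBr addrACA -opprD -scalerDl subrKC scale1r.
have [|L Lp Lf] := @convex_sublinear_linear _ _ _ f j p m sp fNy fcvx jaff.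
  move=> z; rewrite leNgt; apply/negP => h; apply: (hN z).
  rewrite /m in h; apply: le_lt_trans h.
  rewrite leeD2l// lee_fin /p /=; rewrite le_eqVlt; apply/predU1P; left.
  congr (_ + _ * _ + _).
  by apply: eq_bigr => i _; rewrite mxE.
have [||y0 y0E] := @linear_bounded_dual _ V (fun x => L (x, 0, 0)) d.
- move=> t x y /=; rewrite -linearP.
  by congr (L (_, _, _)); rewrite /= scaler0 addr0.
- move=> x; apply: le_trans (Lp _) _; rewrite /p /= normr0 big1 ?mulr0 ?addr0//.
  by move=> i _; rewrite mxE normr0.
have [||y2 y2E] := @linear_bounded_dual _ W (fun x => L (0, 0, x)) N.
- move=> t x y /=; rewrite -linearP.
  by congr (L (_, _, _)); rewrite /= scaler0 addr0.
- move=> x; apply: le_trans (Lp _) _; rewrite /p /= normr0 big1 ?mulr0 ?add0r//.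
  by move=> i _; rewrite mxE normr0.
(* As there are finitely many [xi i], the middle component of [L] is given by coefficients, and it
   pulls back to an element of [dual V]. *)
pose l i : R := L (0, delta_mx 0 i, 0).
pose y1 : dual V := y0 + \sum_i l i *: xi i.
have y1E (x : dual (dual V)) : x y1 = x y0 + \sum_i l i * x (xi i) :> R.
  rewrite linearD linear_sum; congr (_ + _).
  by apply: eq_bigr => i _; rewrite linearZ.
have lM : linear (fun r : 'rV[R]_n => L (0, r, 0)).
  move=> t x y /=; rewrite -linearP.
  by congr (L (_, _, _)); rewrite /= scaler0 addr0.
pose M : {linear 'rV[R]_n -> R^o} :=
  HB.pack (fun r => L (0, r, 0))
    (GRing.isLinear.Build R 'rV[R]_n R^o *:%R _ lM).
have LE z : L (j z) = y1 z.1 + y2 z.2 - \sum_i l i * xss (xi i) - y2 w :> R.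
  have -> : L (j z) = L (z.1, 0, 0) + M (j z).1.2 + L (0, 0, z.2 - w) :> R.
    by rewrite -!linearD; congr (L (_, _, _)); rewrite /= !(addr0, add0r).
  rewrite -y0E -y2E linearB (row_sum_delta (j z).1.2) linear_sum.
  rewrite -[y1 z.1]/(bidual_emb z.1 y1) y1E.
  have -> : \sum_i M ((j z).1.2 0 i *: 'e_i) =
      \sum_i l i * xi i z.1 - \sum_i l i * xss (xi i) :> R.
    rewrite -sumrB; apply: eq_bigr => i _.
    by rewrite linearZ /= mxE -/(l i) /GRing.scale /=; ring.
  by rewrite [bidual_emb z.1 y0]/=; lra.
pose s : R := \sum_i l i * xss (xi i).
pose y : dual V * dual W := (- y1, - y2).
have y_1 x : y.1 x = - (y1 x : R) :> R by [].
have y_2 x : y.2 x = - (y2 x : R) :> R by [].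
have fy_le : (fenchel_conj f y <= (- (m + s + y2 w))%:E)%E.
  apply/fenchel_conj_le => z; have := Lf z; rewrite LE y_1 y_2 -/s.
  case: (f z) => [a| |]; rewrite ?leey// -EFinD !lee_fin; lra.
have y0_le : `|y0| <= d.
  apply: dual_norm_le_bound => // x; rewrite y0E.
  apply: le_trans (Lp _) _; rewrite /p /= normr0 big1 ?mulr0 ?addr0//.
  by move=> i _; rewrite mxE normr0.
have xy0 : xss y0 <= d * `|xss| :> R.
  apply: le_trans (ler_norm _) _; apply: le_trans (dual_norm_le _ _) _.
  by rewrite mulrC ler_wpM2r.
(* Testing the biconjugate at [y], the terms [s] and [y2 w] cancel. What remains is
   [m - xss y0 <= c], contrary to the choice of [m]. *)
have /fenchel_conj_le/(_ y) := fc.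
move=> /le_trans/(_ fy_le).
have -> : xss y.1 = - (xss y0 + s) :> R.
  by rewrite -y1E; exact: linearN.
have -> : (bidual_emb w) y.2 = - (y2 w : R) :> R by [].
rewrite lee_fin /m; lra.
Qed.

(** A nearly optimal minorant gives [f z > c - d - S - |y.2| * D]. Subtracting this from the
    penalized inequality with error [d] leaves [d * |z.1| + S + D < d * (|xss| + 2) <= e]. Dividing
    by [d] bounds [|z.1|] independently of [e]. *)
Lemma biconj_approx_fin f xss w (c e : R) (t : seq (dual V)) :
  (forall z, (-oo < f z)%E) -> (exists z, f z != +oo%E) -> convex_efun f ->
  fenchel_conj (fenchel_conj f) (xss, bidual_emb w) = c%:E -> 0 < e ->
  exists z, [/\ `|z.1| <= `|xss| + 2,
    (forall y, y \in t -> `|y z.1 - xss y| <= e), `|z.2 - w| <= e &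
    (f z <= (c + e)%:E)%E].
Proof.
move=> fNy fy fcvx fc e0.
have A0 : 0 <= `|xss| by [].
have [d d0 de] : exists2 d : R, 0 < d & d * (`|xss| + 2) <= e.
  exists (e / (`|xss| + 2)); first by rewrite divr_gt0//; lra.
  by rewrite divfK// gt_eqF//; lra.
have [y [b [yb by_]]] : exists y b, (fenchel_conj f y <= b%:E)%E /\
    c - d < xss y.1 + y.2 w - b.
  have : ((c - d)%:E < fenchel_conj (fenchel_conj f) (xss, bidual_emb w))%E.
    by rewrite fc lte_fin; lra.
  move=> /ereal_sup_gt[_ [y _ <-]] /=.
  have := fenchel_conj_gtNy y fy.
  case fyE : (fenchel_conj f y) => [b| |]// _.
  by rewrite -EFinB lte_fin => ?; exists y, b; rewrite fyE.
(* [N] exceeds the loss coefficients 1 of [S] and [|y.2|] of [D] by at least 1. Adding [y.1] to the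
   list makes [S] control [y.1 z.1 - xss y.1]. *)
pose N : R := 2 + `|y.2|.
pose t' := in_tuple (y.1 :: t).
have N0 : 0 <= N by rewrite addr_ge0.
have fc' : (fenchel_conj (fenchel_conj f) (xss, bidual_emb w) <= c%:E)%E.
  by rewrite fc.
have [z] := penalized_inf_lt (tnth t') fNy fcvx fc' (ltW d0) N0 d0.
set S := \sum_i _; set D := `|z.2 - w| => zlt.
have Sge i : `|tnth t' i z.1 - xss (tnth t' i)| <= S.
  by rewrite /S (bigD1 i)//= lerDl sumr_ge0.
have S0 : 0 <= S by rewrite /S sumr_ge0.
have D0 : 0 <= D by rewrite /D.
have zy1 : - S <= y.1 z.1 - xss y.1.
  by have := Sge ord0; rewrite ler_norml => /andP[].
have zy2 : - (`|y.2| * D) <= y.2 z.2 - y.2 w.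
  rewrite lerNl; have := dual_norm_le y.2 (z.2 - w).
  rewrite linearB; apply: le_trans.
  by rewrite -normrN; exact: ler_norm.
have := proj1 (fenchel_conj_le f y b) yb z.
move: zlt; case fzE : (f z) (fNy z) => [a| |]// _.
rewrite -EFinD !lte_fin lee_fin => zlt za.
have yS : 0 <= `|y.2| * S by rewrite mulr_ge0.
have yD : 0 <= `|y.2| * D by rewrite mulr_ge0.
have dz : 0 <= d * `|z.1| by rewrite mulr_ge0// ltW.
have zlt' : a + d * `|z.1| + (2 * S + `|y.2| * S) + (2 * D + `|y.2| * D) <
    c + d * `|xss| + d.
  by move: zlt; rewrite /N !mulrDl; lra.
have de' : d * `|xss| + 2 * d <= e by move: de; rewrite mulrDr; lra.
exists z; split.
- rewrite -(ler_pM2l d0) mulrDr; lra.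
- move=> x xt; have /tnthP[i ->] : x \in t' by rewrite inE xt orbT.
  by apply: le_trans (Sge i) _; lra.
- by rewrite -/D; lra.
- by rewrite fzE lee_fin; lra.
Qed.

(** The conjugate of 0 is 0 at the origin and [+oo] elsewhere, because a linear functional bounded
    above vanishes. *)
Lemma biconj_cst0 xss w :
  fenchel_conj (fenchel_conj (fun _ : V * W => 0%E)) (xss, bidual_emb w) =
  0 :> \bar R.
Proof.
apply/eqP; rewrite eq_le; apply/andP; split.
  apply/fenchel_conj_le => y /=; rewrite subr0.
  have := @fenchel_conj_gtNy R V W (fun=> 0%E) y (ex_intro _ 0 isT).
  case fyE : fenchel_conj => [b| |]; last 2 first.
  - by rewrite leey.
  - by [].
  move=> _; have : (fenchel_conj (fun _ : V * W => 0%E) y <= b%:E)%E.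
    by rewrite fyE.
  move=> /fenchel_conj_le h.
  have {}h z : y.1 z.1 + y.2 z.2 <= b by have := h z; rewrite lee_fin; lra.
  have b0 : 0 <= b by have := h (0, 0); rewrite !linear0; lra.
  have zero (U : normedModType R) (g : dual U) : (forall x, g x <= b) -> g = 0.
    move=> gb; apply: dualP => x; have [//|gx] := eqVneq (g x) 0; exfalso.
    have := gb (((b + 1) / g x) *: x);
    rewrite linearZ /= /GRing.scale /= divfK//; lra.
  have -> : y.1 = 0.
    by apply: zero => x; have := h (x, 0); rewrite /= linear0 addr0.
  have -> : y.2 = 0.
    by apply: zero => x; have := h (0, x); rewrite /= linear0 add0r.
  by rewrite linear0 lee_fin/= addr0.
pose o : dual V * dual W := (0, 0).
have fo : (fenchel_conj (fun _ : V * W => 0%E) o <= 0%:E :> \bar R)%E.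
  by apply/fenchel_conj_le => z; rewrite lee_fin subr0/= addr0.
apply: (@le_trans _ _ ((xss o.1 + bidual_emb w o.2)%:E -
    fenchel_conj (fun _ : V * W => 0%E) o)%E); last first.
  by apply: ereal_sup_ubound; exists o.
by rewrite !linear0 addr0 sub0e oppe_ge0.
Qed.

Lemma biconj_approx f xss w (e : R) (t : seq (dual V)) :
  proper_efun f -> convex_efun f ->
  (-oo < fenchel_conj (fenchel_conj f) (xss, bidual_emb w))%E -> 0 < e ->
  exists z, [/\ `|z.1| <= `|xss| + 2,
    (forall y, y \in t -> `|y z.1 - xss y| <= e), `|z.2 - w| <= e &
    (f z <= fenchel_conj (fenchel_conj f) (xss, bidual_emb w) + e%:E)%E].
Proof.
move=> [fNy fy] fcvx.
case fc : (fenchel_conj (fenchel_conj f) _) => [c| |]// _ e0.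
  exact: biconj_approx_fin fc e0.
(* The biconjugate is [+oo], so the bound on [f z] is vacuous and the zero function supplies the
   other three. *)
have [| | |z [? ? ? _]] := @biconj_approx_fin _ xss w 0 e t _ _ _
  (biconj_cst0 xss w) e0.
- by [].
- by exists 0.
- by move=> s x y _; rewrite !mule0 adde0.
- by exists z; split=> //; rewrite addye// leey.
Qed.

End Biconjugate.

(** Some affine minorant of [f] exceeds [a] at [(xss, w)]. Its values along [z] converge to that
    value: the first component by the assumed convergence tested on [y.1], the second by norm
    continuity of [y.2]. *)
Lemma biconj_liminf (R : realType) (V W : normedModType R) (I : Type)
    (F : set_system I) (z : I -> V * W) (f : V * W -> \bar R)
    (xss : dual (dual V)) (w : W) (a : R) :
  Filter F -> (exists z, f z != +oo%E) ->
  (forall y : dual V, (y (z i).1 : R) @[i --> F] --> (xss y : R)) ->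
  (z i).2 @[i --> F] --> w ->
  (a%:E < fenchel_conj (fenchel_conj f) (xss, bidual_emb w))%E ->
  \forall i \near F, (a%:E < f (z i))%E.
Proof.
move=> FF fy cy1 cz2 /ereal_sup_gt[_ [y _ <-]] /=.
have := fenchel_conj_gtNy y fy.
case fyE : (fenchel_conj f y) => [b| |]// _.
rewrite -EFinB lte_fin => ab.
have yb : (fenchel_conj f y <= b%:E)%E by rewrite fyE.
have cy2 : (y.2 (z i).2 : R) @[i --> F] --> (y.2 w : R).
  by apply: (cvg_comp _ _ cz2); exact: dual_continuous.
have cy : (y.1 (z i).1 + y.2 (z i).2 - b : R) @[i --> F] -->
    (xss y.1 + y.2 w - b : R).
  by apply: cvgB; [apply: cvgD|apply: cvg_cst].
near=> i; apply: lt_le_trans (proj1 (fenchel_conj_le f y b) yb (z i)).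
by rewrite lte_fin; near: i; exact: (cvgr_gt _ cy _ ab).
Unshelve. all: by end_near. Qed.

(** * Construction of the net and its limits *)

Theorem theorem4p2 (R : realType) (X : completeNormedModType R)
    (f : X * dual X -> \bar R)
    (f_proper : proper_efun f) (f_convex : convex_efun f)
    (f_lsc : lower_semicontinuous f)
    (xss : dual (dual X)) (xs : dual X) :
  exists (I : Type) (le : I -> I -> Prop) (z : I -> X * dual X),
    [/\ directed_preorder le,
        bounded_fun z,
        (bidual_emb (z i).1 : weak_star (dual X), (z i).2)
          @[i --> net_filter le] --> (xss : weak_star (dual X), xs) &
        f (z i) @[i --> net_filter le]
          --> fenchel_conj (fenchel_conj f) (xss, bidual_emb xs)].
Proof.
set c := fenchel_conj (fenchel_conj f) _.
(* Lower semicontinuity enters here: an affine minorant makes [f^*] differ from [+oo] somewhere, so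
   [f^**] avoids [-oo]. *)
have cNy : (-oo < c)%E.
  by apply: fenchel_conj_gtNy; exact: lsc_convex_minorant.
(* An index is a finite list of functionals to be tested and a precision level; concatenation and
   maximum give upper bounds. *)
pose I := (seq (dual X) * nat)%type.
pose le (i j : I) := {subset i.1 <= j.1} /\ (i.2 <= j.2)%N.
pose e n : R := n.+1%:R^-1.
have e0 n : 0 < e n by rewrite invr_gt0.
have ele m n : (m <= n)%N -> e n <= e m.
  by move=> mn; rewrite lef_pV2 ?posrE// ler_nat.
have /choice[z zP] (i : I) : exists zi : X * dual X,
    [/\ `|zi.1| <= `|xss| + 2,
      (forall y, y \in i.1 -> `|y zi.1 - xss y| <= e i.2),
      `|zi.2 - xs| <= e i.2 & (f zi <= c + (e i.2)%:E)%E].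
  exact: biconj_approx.
have dle : directed_preorder le.
  split; first by exists ([::], 0%N).
  - by move=> i; split.
  - move=> i j k [ij ij'] [jk jk']; split=> [y /ij/jk//|].
    exact: leq_trans jk'.
  - move=> i j; exists (i.1 ++ j.1, maxn i.2 j.2); split=> /=.
    + by move=> y yi; rewrite mem_cat yi.
    + exact: leq_maxl.
    + by move=> y yj; rewrite mem_cat yj orbT.
    + exact: leq_maxr.
have PF := net_filter_proper dle.
have net_near (P : I -> Prop) i : (forall j, le i j -> P j) ->
    \forall j \near net_filter le, P j by move=> iP; exists i.
have small (r : R) : 0 < r -> exists n, e n < r.
  by move=> /ltr_add_invr[n]; rewrite add0r; exists n.
have cz1 (y : dual X) : (y (z i).1 : R) @[i --> net_filter le] --> (xss y : R).
  apply/cvgrPdist_lt => r /small[n nr].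
  apply: (net_near _ ([:: y], n)) => i [yi ni]; rewrite distrC.
  have [_ zi _ _] := zP i; apply: le_lt_trans (zi y _) _.
    by apply: yi; rewrite inE.
  exact: le_lt_trans (ele _ _ ni) nr.
have cz2 : (z i).2 @[i --> net_filter le] --> xs.
  apply/cvgrPdist_lt => r /small[n nr].
  apply: (net_near _ ([::], n)) => i [_ ni]; rewrite distrC.
  have [_ _ zi _] := zP i; apply: le_lt_trans zi _.
  exact: le_lt_trans (ele _ _ ni) nr.
have liminf a : (a%:E < c)%E ->
      \forall i \near net_filter le, (a%:E < f (z i))%E.
  by apply: biconj_liminf => //; case: f_proper.
exists I, le, z; split=> //.
(* The product norm is a maximum. The components are bounded by [|xss| + 2] and, as [e n <= 1], by
   [1 + |xs|]; this sum dominates both. *)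
- exists (`|xss| + 2 + `|xs|); split; first exact: num_real.
  move=> M /ltW hM i _; apply: le_trans hM.
  have [z1 _ z2 _] := zP i.
  have z2' : `|(z i).2| <= 1 + `|xs|.
    rewrite -[(z i).2](subrK xs); apply: le_trans (ler_normD _ _) _.
    rewrite lerD2r; apply: le_trans z2 _.
    by rewrite invf_le1// ler1n.
  rewrite prod_normE ge_max; apply/andP; split.
    by apply: le_trans z1 _; rewrite lerDl.
  by apply: le_trans z2' _; rewrite lerD2r; have : 0 <= `|xss| by []; lra.
- have cw : (bidual_emb (z i).1 : weak_star (dual X)) @[i --> net_filter le] -->
      (xss : weak_star (dual X)).
    by apply/weak_star_cvgP => y; exact: cz1.
  exact: (cvg_pair cw cz2).
(* For [c = +oo] the lower bounds alone give the limit; for real [c] they are combined with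
   [f (z i) <= c + e i.2]. *)
- move: cNy liminf zP; case: c => [c| |]// _ liminf zP; last first.
    by apply/cvgeyPgt => a; apply: liminf; rewrite ltry.
  move=> A Ac.
  have /nbhs_ballP[r /= r0 rA] : \forall x \near c, A x%:E by exact: Ac.
  have [n nr] := small r r0.
  have := liminf (c - r); rewrite lte_fin => /(_ _)/wrap[|lo]; first by lra.
  have up : \forall i \near net_filter le, (f (z i) < (c + r)%:E)%E.
    apply: (net_near _ ([::], n)) => i [_ ni].
    have [_ _ _ zi] := zP i; apply: le_lt_trans zi _.
    by rewrite -EFinD lte_fin ltrD2l; exact: le_lt_trans (ele _ _ ni) nr.
  apply: filterS2 lo up => i /=; case: (f (z i)) => [a| |]//.
  rewrite !lte_fin => lo up; apply: (rA a).
  by rewrite -ball_normE /= ltr_norml; apply/andP; split; lra.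
Qed.
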